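(* Let $k\geq 2$ be an integer. There exists a planar signed bipartite graph $[G,\Sigma]$ of unbalanced-girth $2k$ such that in $[G,\Sigma]^{(2k-2)}$ each part of the bipartition of $G$ induces a graph containing a clique of size at least $2^{2k-2}$.
   Context: A signature on a graph $G$ is a set $\Sigma\subseteq E(G)$ of edges declared negative. Re-signing at a vertex set $X$ changes the sign of every edge with exactly one end in $X$; two signatures are equivalent if one is obtained from the other by re-signing, and a signed graph $[G,\Sigma]$ is $G$ together with the class of signatures equivalent to $\Sigma$. A signed bipartite graph is a signed graph whose underlying graph is bipartite. A cycle is unbalanced if it has an odd number of negative edges; the unbalanced-girth is the length of a shortest unbalanced cycle. For a signed bipartite graph $[G,\Sigma]$ with bipartition $(X,Y)$ and an even integer $r\geq 2$, $[G,\Sigma]^{(r)}$ is the (unsigned) graph on $V(G)$ in which two distinct vertices $u,v$ are adjacent if and only if (i) $u$ and $v$ lie in the same part, and (ii) there are $u,v$-paths $P_1,P_2$ in $G$, each of length at most $r$, such that $P_1$ has an odd number of negative edges and $P_2$ has an even number of negative edges. *)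

(* Defs.v *)
From mathcomp Require Import all_boot.
From Stdlib Require Import Reals.

Set Implicit Arguments.
Unset Strict Implicit.
Unset Printing Implicit Defensive.

Definition simple_graph (V : finType) (e : rel V) : Prop :=
  (forall u v, e u v = e v u) /\ (forall u, ~~ e u u).

(* A signature is encoded by a symmetric relation [sg]: an edge uv is
   negative iff [sg u v]; its values on non-edges are irrelevant. *)
Definition signature (V : finType) (sg : rel V) : Prop :=
  forall u v, sg u v = sg v u.

Fixpoint neg_count (V : finType) (sg : rel V) (x : V) (s : seq V) : nat :=
  match s with
  | [::] => 0
  | y :: s' => sg x y + neg_count sg y s'
  end.

Definition path_par (V : finType) (e sg : rel V) (r : nat) (u v : V)
    (par : bool) : Prop :=
  exists s : seq V, [/\ path e u s, last u s = v, uniq (u :: s),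
                        size s <= r & odd (neg_count sg u s) = par].

Definition unbalanced_cycle (V : finType) (e sg : rel V) (c : seq V) : Prop :=
  match c with
  | [::] => False
  | x :: s => [/\ 3 <= size c, uniq c, cycle e c &
                 odd (neg_count sg x (rcons s x))]
  end.

Definition unbalanced_girth (V : finType) (e sg : rel V) (g : nat) : Prop :=
  (exists c, unbalanced_cycle e sg c /\ size c = g) /\
  (forall c, unbalanced_cycle e sg c -> g <= size c).

Definition bipartition (V : finType) (e : rel V) (part : V -> bool) : Prop :=
  forall u v, e u v -> part u != part v.

Definition power_adj (V : finType) (e sg : rel V) (part : V -> bool)
    (r : nat) (u v : V) : Prop :=
  [/\ u <> v, part u = part v,
      path_par e sg r u v true & path_par e sg r u v false].

(* Planarity (topological definition): the vertices are mapped injectively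
   to points of R^2, each edge uv to a continuous injective arc on [0,1]
   from the point of u to the point of v, arcs avoid vertex points in their
   interior, and interiors of arcs of distinct edges are disjoint.
   (arc u v for each ordered adjacent pair; arcs u v and v u represent the
   same edge and are not required to be disjoint.)  Continuity is required
   on all of R, which is harmless since any continuous map on [0,1] extends
   continuously to R. *)
Definition in01 (t : R) : Prop := (0 <= t <= 1)%R.
Definition in01o (t : R) : Prop := (0 < t < 1)%R.

Definition planar (V : finType) (e : rel V) : Prop :=
  exists (pos : V -> R * R) (arc : V -> V -> R -> R * R),
    (forall u v, pos u = pos v -> u = v) /\
    (forall u v, e u v ->
       [/\ continuity (fun t => fst (arc u v t)),
           continuity (fun t => snd (arc u v t)),
           arc u v 0%R = pos u, arc u v 1%R = pos v &
           forall t t', in01 t -> in01 t' -> arc u v t = arc u v t' -> t = t']) /\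
    (forall u v w t, e u v -> in01o t -> arc u v t <> pos w) /\
    (forall u v u' v' t t', e u v -> e u' v' ->
       ~ (u = u' /\ v = v') -> ~ (u = v' /\ v = u') ->
       in01o t -> in01o t' -> arc u v t <> arc u' v' t').

(* Main.v *)
(* Put N = 2k-1.  Arrange the integers 0 < x < 2^N as the in-order numbering of
   a binary tree: if e is the 2-adic valuation of x, the subtree of x fills the
   interval (x - 2^e, x + 2^e), whose ends are ancestors of x or extreme.  Draw x as
   a vertical path from a vertex top x to a vertex bot x, let top x hang from
   top (x + 2^e) and bot x stand on bot (x - 2^e); for odd x just join top (x + 1)
   to bot (x - 1).  Each 0 <= z < 2^N then has a leaf vertex, joined to the upmost
   vertex by a path whose length is the number of zeros among the N binary digits
   of z, and to the lowest vertex by one whose length is the number of ones.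
   Glue N+1 = 2k copies (petals) of this graph along their upmost and lowest
   vertices and join these two by a negative edge.  The path from top x to bot x
   has length N - e and exactly one negative edge.

   Each edge flips one binary digit, its label (the path from top x to bot x uses
   the labels e+1, ..., N).  An unbalanced closed walk uses each of the labels
   0, ..., N an odd number of times, so its length is at least N+1.

   In the petal c, keep the leaves z with exactly c ones.  Two of them in the same
   petal first differ at some digit e, and the walk through top x and bot x,
   where x is the node that separates them, is negative of length N-1.  Two of
   them in petals a < b of the same parity are joined by a negative walk of length
   a + 1 + (N - b) through the edge between the extreme vertices.  Positive walks
   go through one extreme vertex.  Each parity of c contributes 2^(N-1) leaves. *)

From Stdlib Require Import Reals Lra IndefiniteDescription.
Require Import Defs.
From mathcomp Require Import all_boot zify boolp.

Delimit Scope R_scope with R.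

Set Implicit Arguments.
Unset Strict Implicit.
Unset Printing Implicit Defensive.

(** * Planarity from bar visibility representations *)

Section BarVisibility.

Lemma INR_ltn m n : m < n -> (INR m + 1 <= INR n)%R.
Proof. by move=> mn; rewrite -S_INR; apply: le_INR; apply/leP. Qed.

Lemma ltn_INR m n : (INR m < INR n)%R -> m < n.
Proof. by move=> h; apply/ltP; apply: INR_lt. Qed.

Lemma leq_INR m n : m <= n -> (INR m <= INR n)%R.
Proof. by move=> mn; apply: le_INR; apply/leP. Qed.

Lemma INR_neq m n : INR m <> INR n -> m != n.
Proof. by move=> ne; apply/eqP => mn; apply: ne; rewrite mn. Qed.

(** This is the tent function max(0, 1 - 2|s|), with the maximum written through an absolute value
    so that continuity follows by composition. *)
Definition bump (s : R) : R := ((1 - 2 * Rabs s + Rabs (1 - 2 * Rabs s)) / 2)%R.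

Lemma bump0 : bump 0 = 1%R.
Proof. by rewrite /bump Rabs_R0 Rmult_0_r Rminus_0_r Rabs_R1; lra. Qed.

Lemma bump_far s : (1 / 2 <= Rabs s)%R -> bump s = 0%R.
Proof. by move=> h; rewrite /bump [Rabs (1 - _)]Rabs_left1; lra. Qed.

Lemma bump_bounds s : s <> 0%R -> (0 <= bump s < 1)%R.
Proof.
move=> /Rabs_pos_lt s0; rewrite /bump.
by case: (Rle_lt_dec 0 (1 - 2 * Rabs s)) => h;
  [rewrite [Rabs (1 - _)]Rabs_right | rewrite [Rabs (1 - _)]Rabs_left]; lra.
Qed.

Lemma continuity_bump (g : R -> R) :
  continuity g -> continuity (fun t => bump (g t)).
Proof.
move=> cg; rewrite /bump.
have cst c : continuity (fun _ : R => c) by apply: continuity_const => ? ?.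
have cA : continuity (fun t => Rabs (g t)).
  by apply: (continuity_comp g Rabs cg); exact: Rcontinuity_abs.
have cB : continuity (fun t => 1 - 2 * Rabs (g t))%R.
  apply: (continuity_minus (fun=> 1%R)) => //.
  exact: (continuity_mult (fun=> 2%R)).
have cC : continuity (fun t => Rabs (1 - 2 * Rabs (g t)))%R.
  by apply: (continuity_comp _ Rabs cB); exact: Rcontinuity_abs.
apply: (continuity_mult _ (fun=> (/ 2)%R)) => //.
exact: (continuity_plus _ _ cB cC).
Qed.

Lemma nearest_nat (y : R) : (0 <= y)%R ->
  exists n : nat, (- / 2 <= y - INR n <= / 2)%R.
Proof.
move=> y0; have [h1 h2] := archimed (y - / 2).
have u0 : (0 <= up (y - / 2))%Z.
  have : (-1 < up (y - / 2))%Z by apply: lt_IZR; lra.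
  by lia.
have [n nE] := IZN _ u0.
by exists n; rewrite INR_IZR_INZ -nE; lra.
Qed.

(* A bar visibility representation: the vertex [u] is the horizontal bar
   [[l u, r u]] at height [lev u], and an edge is a vertical segment between
   two bars that meets no other bar.  Each bar is shrunk to its left end; the
   edges bend only at distance less than 1/2 of the levels of their ends. *)
Lemma bar_visibility_planar (V : finType) (e : rel V) (lev l r : V -> nat) :
  (forall u, l u <= r u) ->
  (forall u v c, lev u = lev v -> l u <= c <= r u -> l v <= c <= r v -> u = v) ->
  (forall u v, e u v -> lev u <> lev v) ->
  (forall u v, e u v -> exists c,
     [/\ l u <= c <= r u, l v <= c <= r v &
         forall w, l w <= c <= r w ->
           ~ (lev u < lev w < lev v) /\ ~ (lev v < lev w < lev u)]) ->
  planar e.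
Proof.
move=> lr disj levN vis.
have [col colP] : exists col : V -> V -> nat, forall u v, e u v ->
     [/\ l u <= col u v <= r u, l v <= col u v <= r v &
         forall w, l w <= col u v <= r w ->
           ~ (lev u < lev w < lev v) /\ ~ (lev v < lev w < lev u)].
  have h (uv : V * V) : exists c, e uv.1 uv.2 ->
     [/\ l uv.1 <= c <= r uv.1, l uv.2 <= c <= r uv.2 &
         forall w, l w <= c <= r w -> ~ (lev uv.1 < lev w < lev uv.2) /\
                                      ~ (lev uv.2 < lev w < lev uv.1)].
    case E: (e uv.1 uv.2); last by exists 0.
    by have [c cP] := vis _ _ E; exists c.
  have [f fP] := functional_choice _ h.
  by exists (fun u v => f (u, v)) => u v; apply: (fP (u, v)).
pose X u := INR (l u); pose Y u := INR (lev u).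
pose K u v := INR (col u v).
pose y u v t := (Y u + t * (Y v - Y u))%R.
(* The arc follows its column [K u v]; near the level of an end, a bump pulls it to the left end of
   that bar. Levels of adjacent vertices are at least 1 apart, so at most one bump is nonzero at a
   time. *)
pose x u v t := (K u v + (X u - K u v) * bump (y u v t - Y u)
                       + (X v - K u v) * bump (y u v t - Y v))%R.
have Ygap u v : e u v -> (Y u + 1 <= Y v \/ Y v + 1 <= Y u)%R.
  move=> /levN /eqP; rewrite neq_ltn => /orP[] h; [left | right];
  exact: INR_ltn.
have yrange u v t : e u v -> in01o t ->
    (Y u < y u v t < Y v \/ Y v < y u v t < Y u)%R.
  by move=> /Ygap + [? ?]; rewrite /y => -[h|h]; [left | right]; split; nra.
have posinj u v : (X u, Y u) = (X v, Y v) -> u = v.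
  move=> [/INR_eq lE /INR_eq levE].
  by apply: (disj _ _ (l u)) => //; rewrite ?leqnn /= ?lr // lE leqnn lr.
(* On [[n - 1/2, n + 1/2]] an edge interpolates between its column [K] and
   its position [P] at height [n]. *)
have xE u v t n : e u v -> in01o t -> (- / 2 <= y u v t - INR n <= / 2)%R ->
    exists P, x u v t = (K u v + (P - K u v) * bump (y u v t - INR n))%R /\
      ((exists w, [/\ lev w = n, l w <= col u v <= r w, P = X w
                   & y u v t <> INR n]) \/
       [/\ P = K u v & forall w, lev w = n -> ~ (l w <= col u v <= r w)]).
  move=> euv t01 near.
  have [barU barV between] := colP _ _ euv.
  have range := yrange _ _ _ euv t01; have gap := Ygap _ _ euv.
  have far w : INR n <> Y w -> bump (y u v t - Y w) = 0%R.
    move=> /INR_neq nw; apply: bump_far.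
    move: nw; rewrite neq_ltn => /orP[] /INR_ltn; rewrite /Y => h.
      by rewrite Rabs_left1; lra.
    by rewrite Rabs_right; lra.
  case: (Req_dec (INR n) (Y u)) => [nu|nu].
    exists (X u); split.
      by rewrite /x nu (far v); [lra | rewrite nu; lra].
    left; exists u; split=> //; first exact/INR_eq/esym.
    by rewrite nu; lra.
  case: (Req_dec (INR n) (Y v)) => [nv|nv].
    exists (X v); split.
      by rewrite /x nv (far u); [lra | rewrite nv; lra].
    left; exists v; split=> //; first exact/INR_eq/esym.
    by rewrite nv; lra.
  exists (K u v); split; first by rewrite /x !far //; lra.
  right; split=> // w wn /between[b1 b2].
  move: nu nv => /INR_neq nu /INR_neq nv.
  case: range => range.
    apply: b1; rewrite wn; apply/andP; split.
      move: nu; rewrite neq_ltn => /orP[/INR_ltn|//]; rewrite /Y in range; lra.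
    move: nv; rewrite neq_ltn => /orP[//|/INR_ltn]; rewrite /Y in range; lra.
  apply: b2; rewrite wn; apply/andP; split.
    move: nv; rewrite neq_ltn => /orP[/INR_ltn|//]; rewrite /Y in range; lra.
  move: nu; rewrite neq_ltn => /orP[//|/INR_ltn]; rewrite /Y in range; lra.
exists (fun u => (X u, Y u)), (fun u v t => (x u v t, y u v t)).
split; first exact: posinj.
split.
  move=> u v euv; have gap := Ygap _ _ euv.
  have cst c : continuity (fun _ : R => c) by apply: continuity_const => ? ?.
  have cid : continuity (fun t : R => t).
    by apply: derivable_continuous; exact: derivable_id.
  have cy : continuity (fun t => y u v t).
    apply: (continuity_plus (fun=> Y u)) => //.
    exact: (continuity_mult (fun t => t) (fun=> (Y v - Y u)%R)).
  have cyB c : continuity (fun t => (y u v t - c)%R).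
    exact: (continuity_minus _ (fun=> c)).
  split=> //=.
  - apply: (continuity_plus (fun t => K u v + (X u - K u v) * bump (y u v t - Y u))%R
           (fun t => (X v - K u v) * bump (y u v t - Y v))%R).
      apply: (continuity_plus (fun=> K u v)) => //.
      apply: (continuity_mult (fun=> (X u - K u v)%R)) => //.
      exact: continuity_bump.
    apply: (continuity_mult (fun=> (X v - K u v)%R)) => //.
    exact: continuity_bump.
  - have yE : y u v 0%R = Y u by rewrite /y; lra.
    rewrite /x yE Rminus_diag bump0 bump_far; first by congr pair; lra.
    by case: gap => gap; [rewrite Rabs_left1 | rewrite Rabs_right]; lra.
  - have yE : y u v 1%R = Y v by rewrite /y; lra.
    rewrite /x yE Rminus_diag bump0 bump_far; first by congr pair; lra.
    by case: gap => gap; [rewrite Rabs_right | rewrite Rabs_left1]; lra.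
  - move=> t t' _ _ [_]; rewrite /y => h.
    have : ((t - t') * (Y v - Y u) = 0)%R by lra.
    by move/Rmult_integral => [|] ?; lra.
split.
  move=> u v w t euv t01 [xw yw].
  have near : (- / 2 <= y u v t - INR (lev w) <= / 2)%R by rewrite yw /Y; lra.
  (* At height exactly [lev w] an interior point lies in its column, and no bar of that level meets
     the column; passing through [pos w] would put the column at the left end of the bar of [w]. *)
  have [P [xP]] := xE _ _ _ _ euv t01 near.
  case=> [[w' [_ _ _ []]] // | [PK] /(_ w erefl)]; apply.
  have : K u v = X w by rewrite -xw xP PK; lra.
  by move/INR_eq => ->; rewrite leqnn lr.
move=> u v u' v' t t' euv euv' ne1 ne2 t01 t01' [xx yy].
have range := yrange _ _ _ euv t01; have range' := yrange _ _ _ euv' t01'.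
have [barU barV btw] := colP _ _ euv.
have [barU' barV' btw'] := colP _ _ euv'.
have y0 : (0 <= y u v t)%R.
  by have := pos_INR (lev u); have := pos_INR (lev v); rewrite /Y in range; lra.
have [n near] := nearest_nat y0.
have [P [xP PP]] := xE _ _ _ _ euv t01 near.
rewrite yy in near.
have [P' [xP' PP']] := xE _ _ _ _ euv' t01' near.
(* Edges in different columns are pulled to points in the same weak order, because distinct bars of
   one level are disjoint and each contains its left end. Interpolation with weight below 1 then
   keeps the arcs strictly apart; at height [n] itself, where the weight is 1, both arcs are in
   their columns. *)
have mono a b a' b' s s' Q Q' : (K a b < K a' b')%R -> 
    ((exists w, [/\ lev w = n, l w <= col a b <= r w, Q = X w
                   & s <> INR n]) \/
       [/\ Q = K a b & forall w, lev w = n -> ~ (l w <= col a b <= r w)]) ->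
    ((exists w, [/\ lev w = n, l w <= col a' b' <= r w, Q' = X w
                   & s' <> INR n]) \/
       [/\ Q' = K a' b' & forall w, lev w = n -> ~ (l w <= col a' b' <= r w)]) ->
    (Q <= Q')%R /\ (s = s' -> s = INR n -> (Q < Q')%R).
  move=> /[dup] kk /ltn_INR ck.
  case=> [[w [wn wb -> sn]] | [-> nw]] [[w' [wn' wb' -> sn']] | [-> nw']];
    split; try by move=> ss ns; (have := sn ns) || have := sn' (etrans (esym ss) ns).
  - case: (w =P w') => [-> | ww']; first lra.
    apply: leq_INR; rewrite leqNgt; apply/negP => ll.
    by apply: ww'; apply: (disj _ _ (col a b)) => //; [rewrite wn wn'| lia].
  - apply: leq_INR; rewrite leqNgt; apply/negP => ll.
    by apply: (nw' _ wn); move: wb ll ck; lia.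
  - apply: leq_INR; rewrite leqNgt; apply/negP => ll.
    by apply: (nw _ wn'); move: wb' ll ck; lia.
  - lra.
  - lra.
case: (Rtotal_order (K u v) (K u' v')) => [kk | [kk | kk]].
- have [m1 m2] := mono _ _ _ _ _ _ _ _ kk PP PP'.
  case: (Req_dec (y u v t) (INR n)) => yn.
    have := m2 yy yn; rewrite xP xP' -yy yn Rminus_diag bump0 in xx; lra.
  have [|b1 b2] := @bump_bounds (y u v t - INR n); first lra.
  by rewrite xP xP' -yy in xx; nra.
- move/INR_eq: kk => kk.
  (* Two segments of one column with a common height have the same ends: otherwise an end of one
     would have a level strictly inside the other, although its bar meets the column. *)
  have same a b a' b' z : (Y a < z < Y b)%R -> (Y a' < z < Y b')%R ->
     l a <= col u v <= r a -> l b <= col u v <= r b ->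
     l a' <= col u v <= r a' -> l b' <= col u v <= r b' ->
     (forall w, l w <= col u v <= r w -> ~ (lev a < lev w < lev b)) ->
     (forall w, l w <= col u v <= r w -> ~ (lev a' < lev w < lev b')) ->
     a = a' /\ b = b'.
    move=> [az zb] [az' zb'] ba bb ba' bb' no no'.
    have lab' : lev a < lev b' by apply: ltn_INR; rewrite /Y in az zb'; lra.
    have la'b : lev a' < lev b by apply: ltn_INR; rewrite /Y in az' zb; lra.
    split; apply: (disj _ _ (col u v)) => //; apply/eqP; rewrite eqn_leq; apply/andP;
      split; rewrite leqNgt; apply/negP => ll.
    - by apply: (no' _ ba); rewrite ll lab'.
    - by apply: (no _ ba'); rewrite ll la'b.
    - by apply: (no _ bb'); rewrite lab' || rewrite ll andbT.
    - by apply: (no' _ bb); rewrite la'b ll.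
  rewrite -kk in barU' barV' btw'.
  have b1 w h := (btw w h).1; have b2 w h := (btw w h).2.
  have b1' w h := (btw' w h).1; have b2' w h := (btw' w h).2.
  rewrite -yy in range'.
  case: range => rg; case: range' => rg'.
  + exact: ne1 (same _ _ _ _ _ rg rg' barU barV barU' barV' b1 b1').
  + exact: ne2 (same _ _ _ _ _ rg rg' barU barV barV' barU' b1 b2').
  + by have [? ?] := same _ _ _ _ _ rg rg' barV barU barU' barV' b2 b1'; apply: ne2.
  + by have [? ?] := same _ _ _ _ _ rg rg' barV barU barV' barU' b2 b2'; apply: ne1.
- have [m1 m2] := mono _ _ _ _ _ _ _ _ kk PP' PP.
  case: (Req_dec (y u v t) (INR n)) => yn.
    have := m2 (esym yy) (etrans (esym yy) yn).
    by rewrite xP xP' -yy yn Rminus_diag bump0 in xx; lra.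
  have [|b1 b2] := @bump_bounds (y u v t - INR n); first lra.
  by rewrite xP xP' -yy in xx; nra.
Qed.

End BarVisibility.

(** * Signed walks and edge labels *)

Section SignedWalks.

Variables (V : finType) (e sg : rel V).

(** Walks may repeat vertices, so they can be concatenated and reversed freely; [walk_path] turns
    them into paths at the end. The boolean is the parity of the number of negative edges. *)
Inductive walk : nat -> bool -> V -> V -> Prop :=
| walk_nil u : walk 0 false u u
| walk_cons n p u v w : e u v -> walk n p v w -> walk n.+1 (sg u v (+) p) u w.

Lemma walk_cat n p u v m q w :
  walk n p u v -> walk m q v w -> walk (n + m) (p (+) q) u w.
Proof.
elim=> [//|{}n {}p {}u x {}v eux _ IH] vw.
by rewrite -addbA addSn; apply: walk_cons (IH vw).
Qed.

Lemma walk_edge u v : e u v -> walk 1 (sg u v) u v.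
Proof. by move=> euv; rewrite -[sg u v]addbF; apply/(walk_cons euv)/walk_nil. Qed.

Lemma walk_rev n p u v :
  symmetric e -> symmetric sg -> walk n p u v -> walk n p v u.
Proof.
move=> eC sgC; elim=> [w|{}n {}p {}u x {}v eux _ IH]; first exact: walk_nil.
rewrite sgC addbC -addn1; apply: walk_cat IH _.
by apply: walk_edge; rewrite eC.
Qed.

Lemma neg_count_cat x s t :
  neg_count sg x (s ++ t) = neg_count sg x s + neg_count sg (last x s) t.
Proof. by elim: s x => //= y s IH x; rewrite IH addnA. Qed.

Section Labels.

(* Each edge carries one of the labels [0, ..., N]; the potential [f l] says
   that a closed walk is negative iff it uses the label [l] an odd number of
   times. *)
Variables (N : nat) (f : nat -> V -> bool).
Hypothesis labelP : forall u v, e u v -> exists2 a, a <= N &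
  forall l, l <= N -> f l u (+) f l v (+) sg u v = (l == a).

(** Around a closed walk the potentials telescope, so a negative one uses each of the [N.+1] labels
    an odd number of times, hence at least once, and every edge carries a single label. *)
Lemma negative_closed_walk_long x s :
  path e x s -> last x s = x -> odd (neg_count sg x s) -> N < size s.
Proof.
move=> es lx on.
pose cnt := fix cnt l u s := if s is v :: s' then
  (f l u (+) f l v (+) sg u v) + cnt l v s' else 0.
have cnt_odd l : odd (cnt l x s) = f l x (+) f l (last x s) (+) odd (neg_count sg x s).
  elim: s x {es lx on} => [|y s IH] x /=; first by rewrite addbb.
  rewrite !oddD IH !oddb; case: (f l x); case: (f l y); case: (f l _);
  by case: (sg x y) => //=; case: (odd _).
have cnt_sum : \sum_(l < N.+1) cnt l x s = size s.
  elim: s x es {lx on cnt_odd} => [|y s IH] x /=; first by move=> _; rewrite big1.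
  case/andP=> exy ys; rewrite big_split /= (IH _ ys).
  have [a aN aP] := labelP exy.
  rewrite (bigD1 (inord a)) //= aP ?inordK ?eqxx // big1 // => l nl.
  rewrite aP; last by rewrite -ltnS ltn_ord.
  by apply/eqP; rewrite eqb0; apply: contra nl => /eqP <-; rewrite inord_val.
suff : \sum_(l < N.+1) 1 <= size s by rewrite sum_nat_const card_ord muln1.
rewrite -cnt_sum; apply: leq_sum => l _.
by rewrite odd_gt0 // cnt_odd lx addbb.
Qed.

(** A repeated vertex cuts off a closed walk of length at most [N], which is positive by
    [negative_closed_walk_long]; removing it preserves the parity. *)
Lemma walk_path n p u v : n <= N -> walk n p u v -> path_par e sg n u v p.
Proof.
move=> nN W; elim: W nN => {n p u v} [u|n p u v w euv _ IH] nN.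
  by exists [::]; split.
have [s [es ls us ss os]] := IH (ltnW nN).
case: (boolP (u \in v :: s)) => [us' | us']; last first.
  by exists (v :: s); split=> //=; [rewrite euv | rewrite us' | rewrite oddD oddb os].
case/splitPl: us' es ls us ss os => s1 s2 ls1.
rewrite cat_path last_cat -cat_cons cat_uniq size_cat ls1 neg_count_cat ls1 oddD.
case/andP=> es1 es2 ls2 /and3P[us1 dis us2] ss os.
exists s2; split=> //.
- by move: dis => /hasPn dis; rewrite /= us2 andbT; apply/negP => /dis /=;
    rewrite -ls1 mem_last.
- lia.
have : ~~ odd (neg_count sg u (v :: s1)).
  apply/negP => /negative_closed_walk_long; rewrite /= euv es1 ls1 => /(_ isT erefl).
  lia.
rewrite /= oddD oddb -os => /negbTE ev.
by case: (sg u v) ev => /=; case: (odd (neg_count sg v s1));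
  case: (odd (neg_count sg u s2)).
Qed.

(** Add the equations of [labelP] over all labels: the right-hand sides add up to true, and the sign
    of the edge occurs [N.+1] times, so it cancels for odd [N]. *)
Lemma bipartition_of_labels : odd N ->
  bipartition e (fun u => \big[addb/false]_(l < N.+1) f l u).
Proof.
move=> oN u v euv; have [a aN aP] := labelP euv.
have : \big[addb/false]_(l < N.+1) (f l u (+) f l v (+) sg u v) = true.
  rewrite (bigD1 (inord a)) //= aP ?inordK ?eqxx // big1 // => l nl.
  rewrite aP; last by rewrite -ltnS ltn_ord.
  by apply/negbTE; apply: contra nl => /eqP <-; rewrite inord_val.
rewrite !big_split /= [X in _ (+) X]big_const_ord.
have -> : iter N.+1 (addb (sg u v)) false = false.
  have h m : iter m.*2 (addb (sg u v)) false = false.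
    by elim: m => //= m ->; case: (sg u v).
  by rewrite -(odd_double_half N.+1) /= oN h.
by rewrite addbF; do 2!case: (bigop _ _ _).
Qed.

(** The walk shortens to a positive path, which the negative edge closes to an unbalanced cycle; the
    bound on negative closed walks forces the path to have length exactly [N]. *)
Lemma unbalanced_girth_of_labels u v : 1 < N ->
  e v u -> sg v u -> walk N false u v -> unbalanced_girth e sg N.+1.
Proof.
move=> N1 evu svu W.
have long c : unbalanced_cycle e sg c -> N < size c.
  case: c => // x s [_ _ /= es os].
  have := negative_closed_walk_long es.
  by rewrite last_rcons size_rcons; apply.
split=> //.
have [s [es ls us ss os]] := walk_path (leqnn N) W.
have neg : odd (neg_count sg u (rcons s u)).
  by rewrite -cats1 neg_count_cat oddD os ls /= svu.
have cyc : path e u (rcons s u) by rewrite rcons_path es ls evu.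
have := negative_closed_walk_long cyc.
rewrite last_rcons size_rcons => /(_ erefl neg) sN.
have sizeE : size s = N by apply/eqP; rewrite eqn_leq ss -ltnS.
by exists (u :: s); split; [split=> //=; rewrite sizeE | rewrite /= sizeE].
Qed.

End Labels.

End SignedWalks.

(** * Binary digits and 2-adic valuations *)

Section BinaryDigits.

Definition bit (l x : nat) : bool := odd (x %/ 2 ^ l).

Definition ones (n x : nat) : nat := \sum_(l < n) bit l x.

Lemma onesS n x : ones n.+1 x = ones n x + bit n x.
Proof. by rewrite /ones big_ord_recr. Qed.

Lemma ones_le n x : ones n x <= n.
Proof.
elim: n => [|n IH]; first by rewrite /ones big_ord0.
by rewrite onesS -[n.+1]addn1 leq_add ?leq_b1.
Qed.

Lemma divn_pow2S x l : x %/ 2 ^ l.+1 = (x %/ 2 ^ l)./2.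
Proof. by rewrite expnSr divnMA divn2. Qed.

Lemma bit_mulDr l e h r : r < 2 ^ e ->
  bit l (h * 2 ^ e + r) = if l < e then bit l r else bit (l - e) h.
Proof.
rewrite /bit => re; case: ltnP => le.
  have -> : h * 2 ^ e = h * 2 ^ (e - l.+1) * 2 * 2 ^ l.
    by rewrite -mulnA -expnS -mulnA -expnD subnK.
  by rewrite divnMDl ?expn_gt0 // oddD !oddM andbF.
rewrite -{1}(subnKC le) expnD divnMA divnMDl ?expn_gt0 //.
by rewrite [r %/ _]divn_small // addn0.
Qed.

Lemma bit_pow2_pred l e : l < e -> bit l (2 ^ e).-1.
Proof.
move=> le; rewrite /bit -{1}(subnKC (ltnW le)) expnD mulnC.
have -> : (2 ^ (e - l) * 2 ^ l).-1 = (2 ^ (e - l)).-1 * 2 ^ l + (2 ^ l).-1.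
  have := expn_gt0 2 (e - l); have := expn_gt0 2 l.
  by move: (2 ^ (e - l)) (2 ^ l) => a b /=; nia.
rewrite divnMDl ?expn_gt0 // divn_small ?addn0; last by rewrite prednK ?expn_gt0.
have : 0 < e - l by rewrite subn_gt0.
by case: (e - l) => // m _; rewrite expnS; have := expn_gt0 2 m; lia.
Qed.

Lemma bit_flip e l z : ~~ bit e z -> bit l (z + 2 ^ e) = bit l z (+) (l == e).
Proof.
move=> ez; rewrite (divn_eq z (2 ^ e)) addnAC -mulSnr.
rewrite !bit_mulDr ?ltn_pmod ?expn_gt0 //.
case: ltngtP => // [_|el|->]; first by rewrite addbF.
  rewrite addbF /bit -(subnSK el) !expnS !divnMA !divn2.
  move: ez; rewrite /bit; move: (z %/ _) => y; rewrite -{2 3}[y]odd_double_half.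
  by move=> /negbTE -> /=; rewrite uphalf_double // doubleK.
by rewrite subnn /bit expn0 !divn1 /= addbT.
Qed.

Lemma odd_part x : 0 < x -> exists q, x = (q.*2.+1) * 2 ^ logn 2 x.
Proof.
move=> x0; have [m cop xE] := pfactor_coprime (isT : prime 2) x0.
exists m./2; rewrite {1}xE; congr (_ * _).
by move: cop; rewrite coprime2n => om; rewrite -{1}[m]odd_double_half om.
Qed.

Lemma logn2_odd_mul q e : logn 2 (q.*2.+1 * 2 ^ e) = e.
Proof.
rewrite lognM ?expn_gt0 // pfactorK // logn_coprime // coprime2n /=.
by rewrite odd_double.
Qed.

Lemma bit_low l x : 0 < x -> l <= logn 2 x -> bit l x = (l == logn 2 x).
Proof.
move=> x0; have [q xE] := odd_part x0; move: (logn 2 x) xE => e ->.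
rewrite -[_ * _]addn0 leq_eqVlt bit_mulDr ?expn_gt0 //.
case: ltngtP => // [_ _|-> _]; first by rewrite /bit div0n.
by rewrite subnn /bit divn1 /= odd_double.
Qed.

(** The borrow runs through the trailing zeros up to the lowest digit 1, whose position is the
    valuation. *)
Lemma bit_pred l y : 0 < y -> bit l y.-1 = bit l y (+) (l <= logn 2 y).
Proof.
move=> y0; have [q yE] := odd_part y0; move: (logn 2 y) yE => e ->.
have -> : (q.*2.+1 * 2 ^ e).-1 = q.*2 * 2 ^ e + (2 ^ e).-1.
  by have := expn_gt0 2 e => /=; rewrite mulSn; lia.
have -> : q.*2.+1 * 2 ^ e = q.*2 * 2 ^ e + 2 ^ e by rewrite mulSnr.
rewrite bit_flip; last first.
  by rewrite -[_ * _]addn0 bit_mulDr ?expn_gt0 // ltnn subnn /bit divn1 odd_double.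
rewrite -[q.*2 * _ in RHS]addn0 !bit_mulDr ?expn_gt0 ?prednK ?expn_gt0 // -addbA.
case: ltngtP => [le|el|->] /=; rewrite ?addbF //.
by rewrite bit_pow2_pred // /bit div0n.
Qed.

Lemma bit_inj n x y : x < 2 ^ n -> y < 2 ^ n ->
  (forall l, l < n -> bit l x = bit l y) -> x = y.
Proof.
elim: n x y => [|n IH] x y; first by rewrite !ltnS !leqn0 => /eqP -> /eqP ->.
rewrite expnS => xn yn eb; rewrite -[x]odd_double_half -[y]odd_double_half.
have := eb 0 isT; rewrite /bit !divn1 => ->.
congr (_ + _.*2); apply: IH; [lia | lia |] => l ln.
by have := eb l.+1 ln; rewrite /bit expnS !divnMA !divn2.
Qed.

(** The last equation says, without subtraction, that the digits above [e] contribute equally to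
    both counts. *)
Lemma highest_different_bit n x y : x %/ 2 ^ n = y %/ 2 ^ n -> x <> y ->
  exists e, [/\ e < n, x %/ 2 ^ e.+1 = y %/ 2 ^ e.+1, x %/ 2 ^ e != y %/ 2 ^ e &
     ones n x + ones e.+1 y = ones n y + ones e.+1 x].
Proof.
elim: n => [|n IH] xy ne; first by case: ne; move: xy; rewrite !divn1.
case: (x %/ 2 ^ n =P y %/ 2 ^ n) => [xyn | /eqP nexy].
  have [e [en h1 h2 h3]] := IH xyn ne; exists e.
  have bE : bit n x = bit n y by rewrite /bit xyn.
  split; [exact: leqW en | exact: h1 | exact: h2 |].
  by rewrite (onesS n x) (onesS n y) bE addnAC h3 addnAC.
exists n; split; [exact: ltnSn | exact: xy | exact: nexy |].
exact: addnC.
Qed.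

(** Distinct multiples of [2 ^ logn 2 y] are at least that far apart, so no other one fits in the
    interval. Together with [logn2_above] this gives the nesting of the subtree intervals. *)
Lemma logn2_below x y : 0 < x -> y - 2 ^ logn 2 y < x <= y ->
  x = y \/ logn 2 x < logn 2 y.
Proof.
move=> x0 /andP[lo hi].
have y0 : 0 < y by lia.
case: (ltnP (logn 2 x) (logn 2 y)) => [|le]; first by right.
left; move: lo hi; have [q ->] := odd_part x0; have [p] := odd_part y0.
move: (logn 2 x) (logn 2 y) le => a b ba ->.
rewrite -(subnK ba) expnD mulnA; move: (2 ^ b) (expn_gt0 2 b) => d /= d0.
have -> : p.*2.+1 * d - d = p.*2 * d by rewrite mulSn addKn.
rewrite ltn_pmul2r // leq_pmul2r // => h1 h2.
by congr (_ * _); lia.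
Qed.

Lemma logn2_above x y : 0 < y -> y <= x < y + 2 ^ logn 2 y ->
  x = y \/ logn 2 x < logn 2 y.
Proof.
move=> y0 /andP[lo hi].
have x0 : 0 < x by lia.
case: (ltnP (logn 2 x) (logn 2 y)) => [|le]; first by right.
left; move: lo hi; have [q ->] := odd_part x0; have [p] := odd_part y0.
move: (logn 2 x) (logn 2 y) le => a b ba ->.
rewrite -(subnK ba) expnD mulnA; move: (2 ^ b) (expn_gt0 2 b) => d /= d0.
have -> : p.*2.+1 * d + d = p.*2.+2 * d by rewrite [in RHS]mulSnr.
rewrite ltn_pmul2r // leq_pmul2r // => h1 h2.
by congr (_ * _); lia.
Qed.

Lemma even_of_logn y : 0 < logn 2 y -> ~~ odd y.
Proof. by rewrite logn_gt0 mem_primes => /and3P[_ _]; rewrite dvdn2. Qed.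

(** An odd multiple of a power of two plus that power is an even multiple of it; so valuations grow
    towards the root. *)
Lemma logn2_up x : 0 < x -> logn 2 x < logn 2 (x + 2 ^ logn 2 x).
Proof.
move=> x0; rewrite -pfactor_dvdn // ?addn_gt0 ?x0 //.
have [q xE] := odd_part x0; rewrite {2}xE -mulSnr expnS dvdn_mul //.
by rewrite dvdn2 /= odd_double.
Qed.

Lemma logn2_down x : 2 ^ logn 2 x < x -> logn 2 x < logn 2 (x - 2 ^ logn 2 x).
Proof.
move=> x0; rewrite -pfactor_dvdn // ?subn_gt0 //.
have [q xE] := odd_part (leq_trans (ltn0Sn _) x0).
rewrite {2}xE mulSn addKn expnS dvdn_mul //.
by rewrite dvdn2 odd_double.
Qed.

End BinaryDigits.

(** * The signed graph and the labels of its edges *)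

Section Construction.

Variable N : nat.
Hypothesis N_gt1 : 1 < N.

Definition ncols := N.+1 * 2 ^ N.
Local Notation M := ncols.

Definition seam x := 2 ^ N %| x.
Definition height x := if seam x then N.-1 else logn 2 x.
Definition top x := (if seam x then 0 else x, 0).
Definition bot x := (if seam x then 0 else x, N - height x).

(* The pair [(x, j)] is the [j]-th vertex of the path drawn in the column [x]
   (pairs not reached by an arrow are isolated vertices).  The petal [c] consists
   of the columns between the seams [c * 2 ^ N] and [c.+1 * 2 ^ N]; all seams are
   identified to [(0, 0)] above and to [(0, 1)] below.  The value [N.-1] of
   [height] at seams gives the column [0] length 1, so that [arrow_column] also
   yields the edge between the two extreme vertices. *)
Inductive arrow : nat -> nat * nat -> nat * nat -> Prop :=
| arrow_cross x : x < M -> odd x -> arrow x (top x.+1) (bot x.-1)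
| arrow_column x j : x < M -> (x == 0) || ~~ odd x && ~~ seam x ->
    j < N - height x -> arrow x (x, j) (x, j.+1)
| arrow_top x : x < M -> ~~ odd x -> ~~ seam x ->
    arrow x (top (x + 2 ^ logn 2 x)) (top x)
| arrow_bot x : x < M -> ~~ odd x -> ~~ seam x ->
    arrow x (bot x) (bot (x - 2 ^ logn 2 x)).

Definition vertex : finType := ('I_M.+1 * 'I_N.+1)%type.
Definition coords (u : vertex) : nat * nat := (val u.1, val u.2).
Definition of_coords (p : nat * nat) : vertex := (inord p.1, inord p.2).

Definition edge : rel vertex := fun u v => `[< exists x,
  arrow x (coords u) (coords v) \/ arrow x (coords v) (coords u) >].

(** On arrows this selects the first edge of each column path: the others either have ends in
    different columns or do not have exactly one end at position 0. *)
Definition neg_coords (p q : nat * nat) := (p.1 == q.1) && ((p.2 == 0) (+) (q.2 == 0)).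
Definition negative : rel vertex := fun u v => neg_coords (coords u) (coords v).

Lemma two_lt_pow : 2 < 2 ^ N.
Proof. by rewrite -[2 < _]/(2 ^ 1 < _) ltn_exp2l. Qed.

Lemma seam0 : seam 0. Proof. exact: dvdn0. Qed.

Lemma notseam_gt0 x : ~~ seam x -> 0 < x.
Proof. by case: x => //; rewrite seam0. Qed.

Lemma seamE x : 0 < x -> seam x = (N <= logn 2 x).
Proof. by move=> x0; rewrite /seam pfactor_dvdn. Qed.

Lemma logn_notseam x : ~~ seam x -> logn 2 x < N.
Proof. by move=> /[dup] /notseam_gt0 x0; rewrite seamE // -ltnNge. Qed.

Lemma height_notseam x : ~~ seam x -> height x = logn 2 x.
Proof. by rewrite /height => /negbTE ->. Qed.

Lemma height_lt x : height x < N.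
Proof. by rewrite /height; case: ifPn => [_|/logn_notseam //]; rewrite prednK // ltnW. Qed.

Lemma seam_odd x : odd x -> ~~ seam x.
Proof.
move=> ox; rewrite /seam; apply/negP => /(dvdn_trans _) d; have : 2 %| x.
  by apply: d; apply: (@dvdn_exp2l 2 1); rewrite ltnW.
by rewrite dvdn2 ox.
Qed.

Lemma top_notseam x : ~~ seam x -> top x = (x, 0).
Proof. by rewrite /top => /negbTE ->. Qed.

Lemma bot_notseam x : ~~ seam x -> bot x = (x, N - logn 2 x).
Proof. by move=> nx; rewrite /bot height_notseam // (negbTE nx). Qed.

Lemma top_seam x : seam x -> top x = (0, 0).
Proof. by rewrite /top => ->. Qed.

Lemma bot_seam x : seam x -> bot x = (0, 1).
Proof. by rewrite /bot /height => ->; congr pair; lia. Qed.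

Lemma seam_ncols : seam M. Proof. exact: dvdn_mull. Qed.

Lemma logn_even x : 0 < x -> ~~ odd x -> 0 < logn 2 x.
Proof. by move=> x0 ex; rewrite -pfactor_dvdn // expn1 dvdn2 ex. Qed.

Lemma dvdn_gap d x y : d %| x -> d %| y -> x < y -> x + d <= y.
Proof.
move=> /dvdnP[a ->] /dvdnP[b ->]; rewrite -mulSnr.
by rewrite ltn_mul2r => /andP[_ ab]; rewrite leq_mul2r ab orbT.
Qed.

(** Both sides are multiples of [2 ^ logn 2 x], so a step to the right in the tree never jumps over
    a seam. *)
Lemma next_le x y : ~~ seam x -> seam y -> x < y -> x + 2 ^ logn 2 x <= y.
Proof.
move=> nx ry; apply: dvdn_gap; first exact: pfactor_dvdnn.
by apply: dvdn_trans ry; rewrite dvdn_exp2l // ltnW // logn_notseam.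
Qed.

Lemma pow_logn_le x : 0 < x -> 2 ^ logn 2 x <= x.
Proof. by move=> x0; apply: dvdn_leq => //; exact: pfactor_dvdnn. Qed.

Definition in_range (p : nat * nat) := (p.1 <= M) && (p.2 <= N).

Lemma in_range_top x : x <= M -> in_range (top x).
Proof. by rewrite /in_range /top; case: ifP => //= _ ->. Qed.

Lemma in_range_bot x : x <= M -> in_range (bot x).
Proof. by rewrite /in_range /bot /= leq_subr andbT; case: ifP. Qed.

Lemma arrow_range x p q : arrow x p q -> in_range p /\ in_range q.
Proof.
case=> {x p q} x.
- move=> xM ox; split; [exact: in_range_top | apply: in_range_bot].
  exact: leq_trans (leq_pred _) (ltnW xM).
- move=> j xM _ jN; rewrite /in_range /= (ltnW xM) /=.
  by have jN' := leq_trans jN (leq_subr _ _); rewrite jN' ltnW.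
- move=> xM ex nx; split; apply: in_range_top; last exact: ltnW.
  by apply: next_le => //; exact: seam_ncols.
- move=> xM ex nx; split; apply: in_range_bot; first exact: ltnW.
  exact: leq_trans (leq_subr _ _) (ltnW xM).
Qed.

Lemma of_coordsK p : in_range p -> coords (of_coords p) = p.
Proof. by case: p => x j /andP[/= xM jN]; rewrite /coords /of_coords /= !inordK. Qed.

Lemma coords_inj : injective coords.
Proof. by move=> [x i] [y j] [/val_inj -> /val_inj ->]. Qed.

Lemma edge_arrow x p q : arrow x p q -> edge (of_coords p) (of_coords q).
Proof.
move=> a; have [rp rq] := arrow_range a.
by apply/asboolP; exists x; left; rewrite !of_coordsK.
Qed.

Lemma edgeC : symmetric edge.
Proof. by move=> u v; apply/asboolP/asboolP => -[x []] a; exists x; by [right|left]. Qed.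

Lemma negativeC : symmetric negative.
Proof. by move=> u v; rewrite /negative /neg_coords eq_sym addbC. Qed.

(** A potential for [labelP]. The middle term changes on the column edge from [j] to [j.+1] exactly
    for the label [height p.1 + j.+1]; the last one compensates the negative first edge. The label
    [N] has no binary digit, whence the guard. *)
Definition label l (p : nat * nat) : bool :=
  ((l < N) && bit l p.1) (+) (height p.1 + p.2 < l) (+) (p.2 == 0).

Lemma bit_seam l x : seam x -> l < N -> bit l x = false.
Proof.
rewrite /seam => /dvdnP[q ->] lN.
by rewrite -[_ * _]addn0 bit_mulDr ?expn_gt0 // lN /bit div0n.
Qed.

(** At position 0 the last two terms flip the digits up to the valuation, which is [bit_pred]. At a
    seam all [N] digits are flipped, so the identification of the seams is consistent. *)
Lemma label_top l y : 0 < y -> l <= N -> label l (top y) = (l < N) && bit l y.-1.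
Proof.
move=> y0 lN; rewrite /label addn0 /= addbT bit_pred //.
case: (boolP (seam y)) => [ry | ny].
  have hy : N <= logn 2 y by rewrite -seamE.
  rewrite /height seam0; case: ltnP => lN' /=.
    rewrite !bit_seam ?seam0 // (leq_trans (ltnW lN') hy).
    suff -> : (N.-1 < l) = false by [].
    by apply/negbTE; rewrite -leqNgt -ltnS prednK // ltnW.
  by rewrite (leq_trans _ lN') // prednK // ltnW.
rewrite height_notseam //; case: ltnP => lN' /=.
  by rewrite -addbN -leqNgt.
by rewrite (leq_trans (logn_notseam ny) lN').
Qed.

Lemma label_bot l y : l <= N -> label l (bot y) = (l < N) && bit l y.
Proof.
move=> lN; rewrite /label /bot /=; have hN := height_lt y.
rewrite [_ - _ == 0]eqn0Ngt subn_gt0 hN addbF.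
case: (boolP (seam y)) => [ry | ny]; last first.
  by rewrite (subnKC (ltnW hN)) [N < l]ltnNge lN addbF.
have -> : height 0 = height y by rewrite /height seam0 ry.
rewrite (subnKC (ltnW hN)) [N < l]ltnNge lN addbF; case: ltnP => //= lN'.
by rewrite !bit_seam ?seam0.
Qed.

Lemma neg_cross x : odd x -> neg_coords (top x.+1) (bot x.-1) = false.
Proof.
move=> ox; rewrite /neg_coords /=.
case: ifPn => r1; case: ifPn => r2; apply/negbTE; rewrite negb_and; apply/orP; left.
- have : seam (x.+1 - x.-1) by apply: dvdn_sub.
  have -> : x.+1 - x.-1 = 2 by case: x ox {r1 r2} => // x _; rewrite /= -addn2 addKn.
  by move/(dvdn_leq (isT : 0 < 2)); rewrite leqNgt two_lt_pow.
- by rewrite eq_sym -lt0n notseam_gt0.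
- by [].
- by rewrite gtn_eqF // ltnS leq_pred.
Qed.

Lemma neg_top x y : neg_coords (top x) (top y) = false.
Proof. by rewrite /neg_coords /= andbF. Qed.

Lemma neg_bot x y : neg_coords (bot x) (bot y) = false.
Proof.
by rewrite /neg_coords /= ![_ - _ == 0]eqn0Ngt !subn_gt0 !height_lt andbF.
Qed.

Lemma bit_logn x : 0 < x -> bit (logn 2 x) x.
Proof. by move=> x0; rewrite bit_low ?eqxx. Qed.

(** By [label_top] and [label_bot], [top y] carries the digits of [y.-1] and [bot y] those of [y]. A
    crossing arrow changes digit 0, and a top or bottom arrow the digit [logn 2 x]. *)
Lemma arrow_label x p q : arrow x p q -> exists2 a, a <= N &
  forall l, l <= N -> label l p (+) label l q (+) neg_coords p q = (l == a).
Proof.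
have close l a b1 b2 : a < N -> l <= N -> b1 = b2 (+) (l == a) ->
    ((l < N) && b1) (+) ((l < N) && b2) = (l == a).
  move=> aN lN ->; case: (ltngtP l N) lN => //= [_ _ | -> _].
    by case: b2; case: (l == a).
  by rewrite gtn_eqF.
case=> {x p q} x.
- move=> xM ox; exists 0 => // l lN.
  rewrite label_top // label_bot // neg_cross // addbF /=.
  have x0 : 0 < x by case: x ox {xM}.
  apply: close => //; first exact: ltnW.
  rewrite -[in LHS](prednK x0) -addn1 -[1]/(2 ^ 0) bit_flip // /bit expn0 divn1.
  by case: x x0 ox {xM} => //= x _; rewrite negbK.
- move=> j xM cx jN; exists (height x + j.+1); first by rewrite addnS -ltn_subRL.
  move=> l lN; rewrite /label /neg_coords /= eqxx !addbF addnS.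
  rewrite [height x + j < l]leq_eqVlt [(height x + j).+1 == l]eq_sym.
  by case: (_ && bit _ _); case: j {jN cx} => [|j] /=; case: eqP => [->|_];
    rewrite ?ltnn //; case: (_ < l).
- move=> xM ex nx; exists (logn 2 x); first by rewrite ltnW // logn_notseam.
  move=> l lN; have x0 := notseam_gt0 nx.
  rewrite neg_top addbF !label_top // ?addn_gt0 ?x0 //.
  have -> : (x + 2 ^ logn 2 x).-1 = x.-1 + 2 ^ logn 2 x by rewrite -{1}(prednK x0).
  apply: close => //; first exact: logn_notseam.
  by rewrite bit_flip // bit_pred // bit_logn // leqnn.
- move=> xM ex nx; exists (logn 2 x); first by rewrite ltnW // logn_notseam.
  move=> l lN; have x0 := notseam_gt0 nx; have le := pow_logn_le x0.
  rewrite neg_bot addbF !label_bot //; apply: close => //; first exact: logn_notseam.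
  rewrite -{1}(subnK le) bit_flip //.
  have [q xE] := odd_part x0; rewrite {2}xE mulSn addKn.
  by rewrite -[_ * _]addn0 bit_mulDr ?expn_gt0 // ltnn subnn /bit divn1 odd_double.
Qed.

Lemma edge_label u v : edge u v -> exists2 a, a <= N &
  forall l, l <= N ->
    label l (coords u) (+) label l (coords v) (+) negative u v = (l == a).
Proof.
move=> /asboolP[x [] /arrow_label[a aN aP]]; exists a => // l lN.
by rewrite negativeC [label _ _ (+) label _ _]addbC; exact: (aP l lN).
Qed.


(** * A bar visibility representation of the graph *)

Definition inner x := ~~ odd x && ~~ seam x.
Definition used (p : nat * nat) := ((p.1 == 0) || inner p.1) && (p.2 <= N - height p.1).
(** Column 0 holds the two extreme vertices, so it gets a value above all valuations of inner
    columns instead of the default [logn 2 0 = 0]. *)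
Definition depth x := if x == 0 then N else logn 2 x.

(* Top vertices are placed above the inner vertices of the columns, higher as the
   valuation grows, and symmetrically for the bottom vertices; isolated vertices
   are above everything. *)
Definition level (p : nat * nat) :=
  if ~~ used p then (4 * N + p.2).+1
  else if p.2 == 0 then 3 * N + depth p.1
  else if p.2 == N - height p.1 then N - depth p.1
  else 3 * N - p.2.

(** The tree neighbours below a top vertex lie to its left, and those above a bottom vertex to its
    right; each bar covers just that half of the subtree interval. *)
Definition left_end (p : nat * nat) :=
  if used p && (p.2 == 0) && (p.1 != 0) then (p.1 - 2 ^ logn 2 p.1).+1 else p.1.

Definition right_end (p : nat * nat) :=
  if ~~ used p then p.1
  else if p.1 == 0 then M
  else if p.2 == N - height p.1 then p.1 + (2 ^ logn 2 p.1).-1 else p.1.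

Inductive bar_spec : nat * nat -> nat -> nat -> nat -> Prop :=
| bar_top0 : bar_spec (0, 0) (4 * N) 0 M
| bar_bot0 : bar_spec (0, 1) 0 0 M
| bar_top x : inner x -> bar_spec (x, 0) (3 * N + logn 2 x) (x - 2 ^ logn 2 x).+1 x
| bar_bot x : inner x ->
    bar_spec (x, N - logn 2 x) (N - logn 2 x) x (x + (2 ^ logn 2 x).-1)
| bar_mid x j : inner x -> 0 < j < N - logn 2 x -> bar_spec (x, j) (3 * N - j) x x
| bar_unused p : ~~ used p -> bar_spec p (4 * N + p.2).+1 p.1 p.1.

Lemma barP p : bar_spec p (level p) (left_end p) (right_end p).
Proof.
rewrite /level /left_end /right_end; case: (boolP (used p)); last exact: bar_unused.
case: p => x j; rewrite /used /=; case: (x =P 0) => [-> | /eqP x0] /=.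
  rewrite /height seam0 -subn1 (subKn (ltnW N_gt1)).
  case: j => [|[|//]] _ /=; rewrite /depth /= ?subnn; last exact: bar_bot0.
  by rewrite addnC -mulSn; exact: bar_top0.
case/andP=> ix; have /andP[ex nx] := ix; have lx := logn_notseam nx.
rewrite /depth (negbTE x0) height_notseam //; case: (j =P 0) => [-> | /eqP j0] /= jN.
  by rewrite eq_sym eqn0Ngt subn_gt0 lx; constructor.
case: (j =P _) => [-> | /eqP jN']; first by constructor.
by constructor; rewrite // lt0n j0 ltn_neqAle jN' jN.
Qed.

Lemma inner_logn x : inner x -> [/\ 0 < x, 0 < logn 2 x < N & 2 ^ logn 2 x <= x].
Proof.
case/andP=> ex nx; have x0 := notseam_gt0 nx.
by rewrite pow_logn_le // logn_notseam // logn_even.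
Qed.

Lemma below_pow a c d : 0 < d -> (c <= a + d.-1) = (c < a + d).
Proof. by case: d => // d _; rewrite addnS ltnS. Qed.

(** The six kinds of vertices occupy disjoint ranges of levels. Within the top or the bottom kind
    the level fixes the valuation, and bars of equal valuation are disjoint by [logn2_below] and
    [logn2_above]. *)
Lemma bars_disjoint p q c : level p = level q ->
  left_end p <= c <= right_end p -> left_end q <= c <= right_end q -> p = q.
Proof.
case: (barP p) => [||x ix|x ix|x i ix ii|{}p np];
  case: (barP q) => [||y iy|y iy|y j iy jj|{}q nq] //;
  try (have [x0 lx dx] := inner_logn ix); try (have [y0 ly dy] := inner_logn iy);
  try by lia.
- move=> E xc yc; have {}E : logn 2 x = logn 2 y by lia.
  congr pair; case: (ltngtP x y) => // h.
    by case: (@logn2_below x y x0); lia.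
  by case: (@logn2_below y x y0); lia.
- move=> E xc yc; have {}E : logn 2 x = logn 2 y by lia.
  rewrite E; congr pair; case: (ltngtP x y) => // h.
    by case: (@logn2_above y x x0); lia.
  by case: (@logn2_above x y y0); lia.
- by move=> E ? ?; congr pair; lia.
- by case: p np => a b np; case: q nq => a' b' nq /= E ? ?; congr pair; lia.
Qed.

(** A foreign bar over an inner column [x] is extreme, isolated, or from a column of larger
    valuation, hence beyond the ends of the path drawn in [x]. *)
Lemma column_bar x w : (x == 0) || inner x -> left_end w <= x <= right_end w ->
  [\/ w.1 = x, 3 * N + depth x < level w | level w < N - depth x].
Proof.
case: (barP w) => [||y iy|y iy|y j iy jj|{}w nw] /=; rewrite /depth;
  case: eqP => [-> | x0] /= ix; try (have [y0 ly dy] := inner_logn iy);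
  try (have [x0' lx dx] := inner_logn ix);
  try by move=> ?; constructor; lia.
- move=> h; case: (@logn2_below x y) => // [->|?].
    by constructor.
  by constructor 2; lia.
- move=> h; case: (@logn2_above x y) => // [|->|?]; first lia.
    by constructor.
  by constructor 3; lia.
Qed.




Lemma level_top y : 0 < y -> ~~ odd y ->
  level (top y) = if seam y then 4 * N else 3 * N + logn 2 y.
Proof.
move=> y0 ey; rewrite /top /level /used /depth.
case: (boolP (seam y)) => ry /=; first by lia.
by rewrite /inner ey ry orbT /= (gtn_eqF y0).
Qed.

Lemma level_bot y : ~~ odd y ->
  level (bot y) = if seam y then 0 else N - logn 2 y.
Proof.
move=> ey; rewrite /bot /level /used /depth /=.
have hy : (N - height y == 0) = false by rewrite eqn0Ngt subn_gt0 height_lt.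
case: (boolP (seam y)) => ry /=; rewrite hy.
  have -> : height 0 = height y by rewrite /height seam0 ry.
  by rewrite leqnn eqxx subnn.
by rewrite /inner ey ry orbT leqnn /= eqxx (gtn_eqF (notseam_gt0 ry)).
Qed.

Lemma bar_of_top y c : c <= M -> 0 < y -> ~~ odd y ->
  left_end (top y) <= c <= right_end (top y) =
  seam y || (y - 2 ^ logn 2 y < c <= y).
Proof.
move=> cM y0 ey; rewrite /top /left_end /right_end /used.
case: (boolP (seam y)) => ry /=; first by rewrite cM.
have hy : (0 == N - height y) = false by rewrite eq_sym eqn0Ngt subn_gt0 height_lt.
by rewrite /inner ey ry orbT /= hy (gtn_eqF y0).
Qed.

Lemma bar_of_bot y c : c <= M -> ~~ odd y ->
  left_end (bot y) <= c <= right_end (bot y) =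
  seam y || (y <= c < y + 2 ^ logn 2 y).
Proof.
move=> cM ey; rewrite /bot /left_end /right_end /used.
have hy : (N - height y == 0) = false by rewrite eqn0Ngt subn_gt0 height_lt.
case: (boolP (seam y)) => ry /=.
  have -> : height 0 = height y by rewrite /height seam0 ry.
  by rewrite leqnn andbF.
rewrite hy /inner ey ry orbT leqnn /= eqxx (gtn_eqF (notseam_gt0 ry)).
by rewrite below_pow ?expn_gt0.
Qed.

Lemma self_bar p : p.1 <= M -> left_end p <= p.1 <= right_end p.
Proof.
case: (barP p) => [||x ix|x ix|x j ix _|{}p _] //= pM; rewrite ?leqnn ?leq_addr //.
by have [x0 _ _] := inner_logn ix; have := expn_gt0 2 (logn 2 x); lia.
Qed.

Lemma level_column x j : (x == 0) || inner x ->
  level (x, j) = if N - height x < j then (4 * N + j).+1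
    else if j == 0 then 3 * N + depth x
    else if j == N - height x then N - depth x else 3 * N - j.
Proof. by move=> cx; rewrite /level /used /= cx /= -ltnNge. Qed.

Lemma logn_lt_notseam x n : 0 < x -> logn 2 x < n -> n < N -> ~~ seam x.
Proof. by move=> x0 xn nN; rewrite seamE // -ltnNge (ltn_trans xn). Qed.

(** Arrows point down and are drawn in the column that indexes them. A blocking bar would need a
    valuation for which, by the nesting of the subtree intervals, it cannot reach the column [x]. *)
Lemma arrow_visible x p q : arrow x p q ->
  [/\ level q < level p, left_end p <= x <= right_end p,
      left_end q <= x <= right_end q &
    forall w, left_end w <= x <= right_end w -> ~ (level q < level w < level p)].
Proof.
case=> {x p q} x.
- move=> xM ox; have x0 : 0 < x by case: x ox {xM}.
  have e1 : ~~ odd x.+1 by rewrite /= ox.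
  have e2 : ~~ odd x.-1 by move: ox; rewrite -{1}(prednK x0).
  have pow2 l : 0 < l -> 2 <= 2 ^ l.
    by case: l => // l _; rewrite expnS leq_pmulr ?expn_gt0.
  rewrite bar_of_top ?(ltnW xM) // bar_of_bot ?(ltnW xM) // level_top // level_bot //.
  have tl := logn_even (ltn0Sn x) e1.
  have pN : 3 * N < (if seam x.+1 then 4 * N else 3 * N + logn 2 x.+1) <= 4 * N.
    by case: ifPn => [_|/logn_notseam]; lia.
  have qN : (if seam x.-1 then 0 else N - logn 2 x.-1) <= N by case: ifP => _; lia.
  split.
  + by lia.
  + by have := pow2 _ tl; case: (seam _) => //=; lia.
  + case: (boolP (seam x.-1)) => //= ns.
    by have := pow2 _ (logn_even (notseam_gt0 ns) e2); lia.
  move=> w; case: (barP w) => [||y iy|y iy|y j iy jj|{}w nw]; 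
    try (have [y0 ly dy] := inner_logn iy; have /andP[ey ny] := iy).
  + by lia.
  + by lia.
  + move=> h; have yx : y != x by apply: contra ey => /eqP ->.
    case: (@logn2_below x.+1 y) => // [|->|lt].
    * by move: yx h; lia.
    * by rewrite (negbTE ny) ltnn andbF.
    * rewrite (negbTE (logn_lt_notseam _ lt _)) //; last by case/andP: ly.
      by lia.
  + move=> h; have yx : y != x by apply: contra ey => /eqP ->.
    case: (@logn2_above x.-1 y) => // [|->|lt].
    * by move: yx h; lia.
    * by rewrite (negbTE ny) ltnn.
    * rewrite (negbTE (logn_lt_notseam _ lt _)) //; [|lia|by case/andP: ly].
      by lia.
  + move=> h; have yx : y = x by lia.
    by case/negP: ey; rewrite yx.
  + by lia.
- move=> j xM cx jN; have hN := height_lt x.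
  have dN : depth x <= N.
    by move: cx; rewrite /depth; case: eqP => //= _ /inner_logn[_ ? _]; lia.
  split.
  + by rewrite !level_column //; do !case: ifP => ?; lia.
  + exact: (@self_bar (x, j) (ltnW xM)).
  + exact: (@self_bar (x, j.+1) (ltnW xM)).
  move=> [y i] /(column_bar cx)[/= -> | |];
    rewrite !(@level_column x) //; [|move=> h|move=> h]; do ?case: ifP => ?; lia.
- move=> xM ex nx; have ix : inner x by rewrite /inner ex.
  have [x0 lx dx] := inner_logn ix; have l0 : 0 < logn 2 x by case/andP: lx.
  set y := x + _; have y0 : 0 < y by rewrite addn_gt0 x0.
  have up : logn 2 x < logn 2 y := logn2_up x0.
  have ey : ~~ odd y by apply: even_of_logn; apply: leq_trans up.
  rewrite !bar_of_top ?(ltnW xM) // !level_top // (negbTE nx) /=.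
  have pp := expn_gt0 2 (logn 2 x).
  split.
  + by case: ifP => _; lia.
  + have : 2 ^ logn 2 x < 2 ^ logn 2 y by rewrite ltn_exp2l.
    by rewrite /y; case: (seam _) => //=; lia.
  + lia.
  have pN : (if seam y then 4 * N else 3 * N + logn 2 y) <= 4 * N.
    by case: ifPn => [_|/logn_notseam]; lia.
  move=> w; case: (barP w) => [||z iz|z iz|z j iz jj|{}w nw]; try lia.
  have [z0 lz dz] := inner_logn iz; have /andP[ez nz] := iz.
  move=> h /andP[lxz lzy].
  have xz : x < z.
    rewrite ltn_neqAle; apply/andP; split; last by case/andP: h.
    by apply/eqP => xz; move: lxz; rewrite xz ltnn.
  (* [z] is a multiple of [2 ^ logn 2 x] beyond [x], and [y] is the next such multiple. *)
  have yz : y <= z.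
    apply: dvdn_gap xz; first exact: pfactor_dvdnn.
    by rewrite pfactor_dvdn //; lia.
  case: (@logn2_below y z) => // [|yE|lt]; first by lia.
    by move: lzy; rewrite yE (negbTE nz) ltnn.
  move: lzy; rewrite (negbTE (logn_lt_notseam _ lt _)) //; last by case/andP: lz.
  by lia.
- move=> xM ex nx; have ix : inner x by rewrite /inner ex.
  have [x0 lx dx] := inner_logn ix; have l0 : 0 < logn 2 x by case/andP: lx.
  set y := x - _; have pp := expn_gt0 2 (logn 2 x).
  have down : 0 < y -> logn 2 x < logn 2 y by rewrite subn_gt0; exact: logn2_down.
  have ey : ~~ odd y.
    by rewrite oddB // (negbTE ex) oddX /= orbF -lt0n l0.
  rewrite !bar_of_bot ?(ltnW xM) // !level_bot // (negbTE nx) /=.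
  split.
  + case: ifPn => [_|/notseam_gt0 /down]; lia.
  + lia.
  + case: (boolP (seam y)) => //= /notseam_gt0 /down up.
    have : 2 ^ logn 2 x < 2 ^ logn 2 y by rewrite ltn_exp2l.
    by rewrite /y; lia.
  move=> w; case: (barP w) => [||z iz|z iz|z j iz jj|{}w nw]; try lia.
  have [z0 lz dz] := inner_logn iz; have /andP[ez nz] := iz.
  move=> h /andP[lyz lzx].
  have zx : z < x.
    rewrite ltn_neqAle; apply/andP; split; last by case/andP: h.
    by apply/eqP => zx; move: lzx; rewrite zx ltnn.
  have zy : z <= y.
    rewrite leq_subRL //= addnC; apply: dvdn_gap zx; last exact: pfactor_dvdnn.
    by rewrite pfactor_dvdn //; lia.
  case: (@logn2_above y z) => // [|yE|lt]; first by lia.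
    by move: lyz; rewrite yE (negbTE nz) ltnn.
  move: lyz; rewrite (negbTE (logn_lt_notseam _ lt _)) //; [lia|lia|by case/andP: lz].
Qed.

Lemma planar_edge : planar edge.
Proof.
apply: (@bar_visibility_planar _ _ (fun u => level (coords u))
         (fun u => left_end (coords u)) (fun u => right_end (coords u))).
- move=> u; have [|a b] := andP (@self_bar (coords u) _); first by rewrite -ltnS ltn_ord.
  exact: leq_trans a b.
- by move=> u v c E uc vc; apply: coords_inj; apply: bars_disjoint E uc vc.
- by move=> u v /asboolP[x [] /arrow_visible[lt _ _ _] E]; rewrite E ltnn in lt.
- have asym a b c : a < b -> ~ (b < c < a).
    by move=> ab /andP[bc ca]; have := ltn_trans (ltn_trans bc ca) ab; rewrite ltnn.
  move=> u v /asboolP[x [] /arrow_visible[lt bu bv no]]; exists x; split=> // w bw;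
    by split; [exact: no | exact: asym] || by split; [exact: asym | exact: no].
Qed.


(** * Short walks between leaves and extreme vertices *)

Local Notation wlk n p a b := (walk edge negative n p (of_coords a) (of_coords b)).

(** Both [top z.+1] and [bot z] carry the digits of [z]; the parity selects the one in an even
    column. *)
Definition leaf z := if odd z then top z.+1 else bot z.

Lemma wlk_sym n p a b : wlk n p a b -> wlk n p b a.
Proof. exact: walk_rev edgeC negativeC. Qed.

Lemma arrow_walk x a b : arrow x a b -> wlk 1 (neg_coords a b) a b.
Proof.
move=> ab; have [ra rb] := arrow_range ab.
rewrite -{1}(of_coordsK ra) -{1}(of_coordsK rb).
exact/walk_edge/(edge_arrow ab).
Qed.

Lemma inner_odd_mul q e : 0 < e < N -> inner (q.*2.+1 * 2 ^ e).
Proof.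
case/andP=> e0 eN; have lE := logn2_odd_mul q e.
have x0 : 0 < q.*2.+1 * 2 ^ e by rewrite muln_gt0 expn_gt0.
by rewrite /inner even_of_logn ?lE // seamE // lE -ltnNge.
Qed.


(** The target is the right end of the dyadic interval of length [2 ^ e] around [z]. Passing to
    [e.+1] moves this end, by one top arrow, exactly when digit [e] is 0; in [descend] the left end
    moves when the digit is 1. *)
Lemma climb z e : z < M -> 0 < e <= N ->
  wlk (e - ones e z) false (leaf z) (top ((z %/ 2 ^ e).+1 * 2 ^ e)).
Proof.
move=> zM; elim: e => // -[|e] IH /andP[_ eN].
  rewrite /ones big_ord1 /bit expn0 divn1 /leaf expn1 divn2.
  have zE := odd_double_half z; case: ifP zE => oz zE.
    suff -> : (z./2).+1 * 2 = z.+1 by exact: walk_nil.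
    by rewrite muln2 doubleS -{2}zE.
  (* For even [z] the first step crosses in column [z.+1], which is odd and so differs from the seam
     [M]. *)
  have zM' : z.+1 < M.
    rewrite ltn_neqAle zM andbT; apply: contraTneq seam_ncols => <-.
    by apply: seam_odd => //=; rewrite oz.
  have -> : (z./2).+1 * 2 = z.+2 by rewrite muln2 doubleS -{2}zE.
  apply: wlk_sym; have := arrow_cross zM'; rewrite /= oz => /(_ isT) a.
  by have := arrow_walk a; rewrite (@neg_cross z.+1) //= oz.
have {IH} := IH (ltnW eN); move: e.+1 (ltn0Sn e) eN => {}e e0 eN W.
have lt_next : (z %/ 2 ^ e).+1 * 2 ^ e <= M.
  have dM : 2 ^ e %| M by rewrite dvdn_mull // dvdn_exp2l // ltnW.
  by rewrite -(divnK dM) leq_mul2r ltn_divLR ?expn_gt0 // divnK // zM orbT.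
rewrite divn_pow2S onesS /bit; move: (z %/ 2 ^ e) W lt_next => q.
have [h [b ->]] : exists h (b : bool), q = b + h.*2.
  by exists q./2, (odd q); rewrite odd_double_half.
rewrite expnS mulnA half_bit_double oddD odd_double addbF oddb muln2 doubleS.
case: b => W qM; first by rewrite addn1 subSS.
rewrite addn0 subSn ?ones_le //; rewrite add0n in W qM.
set x := _ * 2 ^ e in W qM.
have ix : inner x by apply: inner_odd_mul; rewrite e0.
have xM : x < M.
  rewrite ltn_neqAle qM andbT; apply: contraTneq seam_ncols => <-.
  by case/andP: ix.
have [ex nx] := andP ix; have := arrow_walk (arrow_top xM ex nx).
rewrite neg_top /x logn2_odd_mul -mulSnr => step.
by rewrite -addn1 -[false]/(false (+) false); apply: walk_cat W (wlk_sym step).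
Qed.

Lemma descend z e : z < M -> 0 < e <= N ->
  wlk (ones e z) false (leaf z) (bot (z %/ 2 ^ e * 2 ^ e)).
Proof.
move=> zM; elim: e => // -[|e] IH /andP[_ eN].
  rewrite /ones big_ord1 /bit expn0 divn1 /leaf expn1 divn2.
  have zE := odd_double_half z; case: ifP zE => oz zE.
    have -> : z./2 * 2 = z.-1 by rewrite muln2 -{2}zE.
    by have := arrow_walk (arrow_cross zM oz); rewrite neg_cross.
  suff -> : z./2 * 2 = z by exact: walk_nil.
  by rewrite muln2 -{2}zE.
have {IH} := IH (ltnW eN); move: e.+1 (ltn0Sn e) eN => {}e e0 eN W.
have := leq_trunc_div z (2 ^ e).
rewrite divn_pow2S onesS /bit; move: (z %/ 2 ^ e) W => q.
have [h [b ->]] : exists h (b : bool), q = b + h.*2.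
  by exists q./2, (odd q); rewrite odd_double_half.
rewrite expnS mulnA half_bit_double oddD odd_double addbF oddb muln2.
case: b => W qz; last by rewrite addn0.
rewrite add1n in W qz.
set x := _ * 2 ^ e in W qz.
have ix : inner x by apply: inner_odd_mul; rewrite e0.
have [ex nx] := andP ix.
have := arrow_walk (arrow_bot (leq_ltn_trans qz zM) ex nx).
rewrite neg_bot // /x logn2_odd_mul mulSn addKn => step.
by rewrite -[false]/(false (+) false); apply: walk_cat W step.
Qed.

Lemma seam_mul q : seam (q * 2 ^ N).
Proof. exact: dvdn_mull. Qed.

Lemma climb_seam z : z < M -> wlk (N - ones N z) false (leaf z) (0, 0).
Proof.
move=> zM; rewrite -(top_seam (seam_mul (z %/ 2 ^ N).+1)).
by apply: climb => //; rewrite leqnn ltnW.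
Qed.

Lemma descend_seam z : z < M -> wlk (ones N z) false (leaf z) (0, 1).
Proof.
move=> zM; rewrite -(bot_seam (seam_mul (z %/ 2 ^ N))).
by apply: descend => //; rewrite leqnn ltnW.
Qed.

Lemma ncols_gt0 : 0 < M. Proof. by rewrite muln_gt0 expn_gt0. Qed.

Lemma seam_walk : wlk 1 true (0, 0) (0, 1).
Proof.
apply: (arrow_walk (@arrow_column 0 0 ncols_gt0 isT _)).
by rewrite subn_gt0 height_lt.
Qed.

Lemma column_walk x : x < M -> inner x -> wlk (N - logn 2 x) true (top x) (bot x).
Proof.
move=> xM ix; have [ex nx] := andP ix.
rewrite top_notseam // bot_notseam //.
have cx : (x == 0) || ~~ odd x && ~~ seam x by rewrite ex nx orbT.
have climb_j j : 0 < j <= N - height x -> wlk j true (x, 0) (x, j).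
  elim: j => // -[|j] IH /andP[_ jN]; have := arrow_walk (arrow_column xM cx jN).
    by rewrite /neg_coords /= eqxx.
  rewrite /neg_coords /= andbF => step.
  by have := walk_cat (IH (ltnW jN)) step; rewrite addn1.
by rewrite -(height_notseam nx); apply: climb_j; rewrite leqnn subn_gt0 height_lt.
Qed.

(** If [z] has the digit 1 at the separating position [e], equal totals give
    [ones e y = ones e z + 1]. The walk has length [(e - ones e y) + (N - e) + ones e z], which is
    [N.-1]. *)
Lemma same_petal y z : y < M -> z < M -> y %/ 2 ^ N = z %/ 2 ^ N ->
  ones N y = ones N z -> y <> z -> wlk N.-1 true (leaf y) (leaf z).
Proof.
move=> yM zM yz oyz ne.
have [e [eN halfE neE onesE]] := highest_different_bit yz ne.
rewrite oyz in onesE; move/addnI: onesE; rewrite !onesS => {oyz} onesE.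
rewrite !divn_pow2S in halfE.
wlog oz : y z yM zM ne yz halfE neE onesE / odd (z %/ 2 ^ e).
  move=> H; case: (boolP (odd (z %/ 2 ^ e))) => oz; first exact: H.
  apply: wlk_sym; apply: H => //; [exact: nesym | by rewrite eq_sym|].
  apply: contraR neE => oy; rewrite -[y %/ _]odd_double_half -[z %/ _]odd_double_half.
  by rewrite halfE (negbTE oz) (negbTE oy).
have oy : ~~ odd (y %/ 2 ^ e).
  apply: contra neE => oy; rewrite -[y %/ _]odd_double_half -[z %/ _]odd_double_half.
  by rewrite halfE oz oy.
have yzE : (y %/ 2 ^ e).+1 = z %/ 2 ^ e.
  rewrite -[y %/ _]odd_double_half -[z %/ _]odd_double_half.
  by rewrite halfE oz (negbTE oy).
have bz : bit e z by [].
have by_ : ~~ bit e y by [].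
rewrite bz (negbTE by_) addn0 in onesE.
have e0 : 0 < e.
  by rewrite lt0n; apply/eqP => e00; move: onesE; rewrite e00 /ones !big_ord0.
have eN' : 0 < e <= N by rewrite e0 ltnW.
set x := z %/ 2 ^ e * 2 ^ e.
have xE : x = ((z %/ 2 ^ e)./2).*2.+1 * 2 ^ e.
  by rewrite /x -{1}[z %/ _]odd_double_half oz.
have lx : logn 2 x = e by rewrite xE logn2_odd_mul.
have ix : inner x by rewrite xE; apply: inner_odd_mul; rewrite e0.
have xM : x < M := leq_ltn_trans (leq_trunc_div _ _) zM.
have up := climb yM eN'; rewrite yzE -/x in up.
have down := wlk_sym (descend zM eN').
have := walk_cat (walk_cat up (column_walk xM ix)) down.
rewrite lx; congr (walk _ _ _ _ _ _).
by have := ones_le e y; lia.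
Qed.


(** * The cliques and the girth *)

Lemma label_leaf l z : l <= N -> label l (leaf z) = (l < N) && bit l z.
Proof.
by move=> lN; rewrite /leaf; case: ifP => _; [rewrite label_top | rewrite label_bot].
Qed.

Lemma leafK z : z < M -> coords (of_coords (leaf z)) = leaf z.
Proof.
move=> zM; apply: of_coordsK; rewrite /leaf.
by case: ifP => _; [apply: in_range_top | apply: in_range_bot; apply: ltnW].
Qed.

Definition part (u : vertex) := \big[addb/false]_(l < N.+1) label l (coords u).

Lemma part_leaf z : z < M -> part (of_coords (leaf z)) = odd (ones N z).
Proof.
move=> zM; rewrite /part leafK // big_ord_recr /= label_leaf // ltnn addbF.
rewrite /ones (big_morph odd oddD (erefl _)); apply: eq_bigr => l _.
by rewrite label_leaf ?(ltnW (ltn_ord l)) // ltn_ord oddb.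
Qed.

Lemma walk_path_par n p a b : n <= N.-1 -> wlk n p a b ->
  path_par edge negative N.-1 (of_coords a) (of_coords b) p.
Proof.
move=> nN /(walk_path edge_label) [|s [es ls us ss os]].
  exact: leq_trans nN (leq_pred N).
by exists s; split=> //; exact: leq_trans ss nN.
Qed.

(** Let a and b be the numbers of ones. If they differ, equal parity gives a gap of at least 2,
    which pays for the edge between the extreme vertices. The positive walks have lengths a + b and
    2N - a - b; as a + b is even and [N] odd, one of them is below [N]. *)
Lemma chosen_leaves_adjacent y z : odd N -> y < M -> z < M ->
  ones N y = y %/ 2 ^ N -> ones N z = z %/ 2 ^ N -> odd (ones N y) = odd (ones N z) ->
  leaf y <> leaf z ->
  power_adj edge negative part N.-1 (of_coords (leaf y)) (of_coords (leaf z)).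
Proof.
move=> oN yM zM cy cz par ne.
have yN := ones_le N y; have zN := ones_le N z.
have h : ones N y + ones N z != N.
  by apply: contraTneq oN => <-; rewrite oddD par addbb.
split.
- by move=> E; apply: ne; rewrite -(leafK yM) -(leafK zM) E.
- by rewrite !part_leaf.
- case: (ltngtP (ones N y) (ones N z)) => [lt|lt|E].
  + have W := walk_cat (walk_cat (descend_seam yM) (wlk_sym seam_walk))
                         (wlk_sym (climb_seam zM)).
    by apply: walk_path_par W; move: par lt oN; lia.
  + have W := walk_cat (walk_cat (climb_seam yM) seam_walk)
                         (wlk_sym (descend_seam zM)).
    by apply: walk_path_par W; move: par lt oN; lia.
  + apply: (@walk_path_par N.-1) => //; apply: same_petal => //.
      by rewrite -cy -cz.
    by move=> yz; apply: ne; rewrite yz.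
- case: (ltngtP (ones N y + ones N z) N) => [lt|lt|E].
  + have W := walk_cat (descend_seam yM) (wlk_sym (descend_seam zM)).
    by apply: walk_path_par W; move: par lt oN; lia.
  + have W := walk_cat (climb_seam yM) (wlk_sym (climb_seam zM)).
    by apply: walk_path_par W; move: par lt oN; lia.
  + by rewrite E eqxx in h.
Qed.

(* The last binary digit is spent on making the number of ones have parity [b]. *)
Definition chosen (b : bool) (m : nat) : nat :=
  let z := (b (+) odd (ones N.-1 m)) + m.*2 in ones N z * 2 ^ N + z.

Lemma chosenP b m : m < 2 ^ N.-1 ->
  [/\ chosen b m < M, ones N (chosen b m) = chosen b m %/ 2 ^ N,
      odd (ones N (chosen b m)) = b &
      forall l, l < N.-1 -> bit l.+1 (chosen b m) = bit l m].
Proof.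
move=> mN; rewrite /chosen; set c := b (+) _; set z := c + m.*2.
have N0 : 0 < N by exact: ltnW.
have bit_z l : bit l.+1 z = bit l m.
  by rewrite /bit expnS divnMA divn2 half_bit_double.
have zN : z < 2 ^ N.
  by rewrite -(prednK N0) expnS /z; case: (c) => /=; lia.
have onesE : ones N (ones N z * 2 ^ N + z) = ones N z.
  by apply: eq_bigr => l _; rewrite bit_mulDr // ltn_ord.
have onez : ones N z = c + ones N.-1 m.
  rewrite /ones -[in LHS](prednK N0) big_ord_recl; congr (_ + _).
    by rewrite /bit expn0 divn1 oddD odd_double addbF oddb.
  by apply: eq_bigr => l _; rewrite lift0 bit_z.
rewrite onesE; split.
- apply: (@leq_trans ((ones N z).+1 * 2 ^ N)); first by rewrite mulSnr ltn_add2l.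
  by rewrite leq_mul2r ltnS ones_le orbT.
- by rewrite divnMDl ?expn_gt0 // divn_small // addn0.
- by rewrite onez oddD oddb /c -addbA addbb addbF.
- move=> l lN; rewrite bit_mulDr //; case: ltnP => // ; lia.
Qed.

Definition clique b : {set vertex} :=
  [set of_coords (leaf (chosen b m)) | m : 'I_(2 ^ N.-1)].

(** The labels of the leaf recover the digits of [m], shifted by one place, so different [m] give
    different vertices. *)
Lemma card_clique b : #|clique b| = 2 ^ N.-1.
Proof.
rewrite card_imset ?card_ord // => m n.
have [mM _ _ mbit] := chosenP b (ltn_ord m).
have [nM _ _ nbit] := chosenP b (ltn_ord n).
move=> /(congr1 coords); rewrite !leafK // => E.
apply/val_inj/(bit_inj (ltn_ord m) (ltn_ord n)) => l lN.
have lN' : l.+1 < N by rewrite -(prednK (ltnW N_gt1)).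
rewrite -mbit // -nbit //.
by have := congr1 (label l.+1) E; rewrite !label_leaf ?(ltnW lN') // lN'.
Qed.

Lemma clique_part b u : u \in clique b -> part u = b.
Proof.
by case/imsetP => m _ ->; have [mM _ mb _] := chosenP b (ltn_ord m); rewrite part_leaf.
Qed.

Lemma clique_adjacent b u v : odd N -> u \in clique b -> v \in clique b -> u <> v ->
  power_adj edge negative part N.-1 u v.
Proof.
move=> oN /imsetP[m _ ->] /imsetP[n _ ->] ne.
have [mM mc mb _] := chosenP b (ltn_ord m).
have [nM nc nb _] := chosenP b (ltn_ord n).
apply: chosen_leaves_adjacent => //; first by rewrite mb nb.
by move=> E; apply: ne; rewrite E.
Qed.

Lemma simple_edge : simple_graph edge.
Proof.
split; first exact: edgeC.
move=> u; apply/negP => /asboolP[x a].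
have : arrow x (coords u) (coords u) by case: a.
by case/(arrow_visible); rewrite ltnn.
Qed.

Lemma girth_edge : unbalanced_girth edge negative N.+1.
Proof.
have in0 : in_range (0, 0) by [].
have in1 : in_range (0, 1) by rewrite /in_range /= ltnW.
have z0 := ncols_gt0.
(* Through the leaf of 0 the extreme vertices are joined by a positive walk whose length counts all
   zeros and ones, that is [N]. *)
have W := walk_cat (wlk_sym (climb_seam z0)) (descend_seam z0).
rewrite subnK ?ones_le // in W.
have e01 := @arrow_column 0 0 ncols_gt0 isT _.
apply: (unbalanced_girth_of_labels edge_label N_gt1 _ _ W).
  by rewrite edgeC; apply/edge_arrow/e01; rewrite subn_gt0 height_lt.
by rewrite /negative !of_coordsK.
Qed.


End Construction.

Theorem theorem5 (k : nat) (hk : 2 <= k) :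
  exists (V : finType) (e sg : rel V) (part : V -> bool),
    [/\ simple_graph e /\ signature sg, planar e, bipartition e part,
        unbalanced_girth e sg (2 * k) &
        forall b : bool, exists C : {set V},
          [/\ (forall x, x \in C -> part x = b),
              2 ^ (2 * k - 2) <= #|C| &
              (forall x y, x \in C -> y \in C -> x <> y ->
                power_adj e sg part (2 * k - 2) x y)]].
Proof.
have [N -> [oN N1]] : exists2 N, 2 * k = N.+1 & odd N /\ 1 < N.
  by exists (2 * k).-1; [|split]; lia.
have -> : N.+1 - 2 = N.-1 by lia.
exists (vertex N), (@edge N), (@negative N), (@part N); split.
- by split; [exact: simple_edge | exact: negativeC].
- exact: planar_edge.
- exact: (bipartition_of_labels (fun u v => @edge_label N N1 u v) oN).
- exact: girth_edge.
move=> b; exists (clique N b); split; [exact: clique_part | by rewrite card_clique |].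
by move=> u v; apply: clique_adjacent.
Qed.
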